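(* (i) For $n\in\mathbb{Z}^+$ let $S(n)$ denote the smallest integer $m>1$ such that the residues $2k(k-1)\bmod m$ for $k=1,\ldots,n$ are pairwise distinct. Then $S(n)$ is the least prime greater than $2n-2$. (ii) For $n\in\mathbb{Z}^+$ let $T(n)$ denote the least integer $m>1$ such that the residues $k(k-1)\bmod m$ with $1\leqslant k\leqslant n$ are pairwise distinct. Then $$T(n)=\min\{m\geqslant 2n-1:\ m \text{ is a prime or a positive power of } 2\}.$$
   Context: $\mathbb{Z}^+=\{1,2,3,\ldots\}$. *)

(* Defs.v *)
From mathcomp Require Import all_boot.
From mathcomp Require Import zify.

Set Implicit Arguments.
Unset Strict Implicit.
Unset Printing Implicit Defensive.

Definition distinct_residues (f : nat -> nat) (n m : nat) : bool :=
  uniq [seq f k %% m | k <- iota 1 n].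

Lemma distinct_residues_exists (f : nat -> nat) (n : nat) :
  {in iota 1 n &, injective f} ->
  exists m, (1 < m) && distinct_residues f n m.
Proof.
move=> f_inj; exists (\max_(k <- iota 1 n) f k).+2 => /=.
rewrite /distinct_residues map_inj_in_uniq ?iota_uniq // => x y xn yn.
have lt_max z : z \in iota 1 n -> f z < (\max_(k <- iota 1 n) f k).+2.
  by move=> zn; rewrite !ltnS leqW // leq_bigmax_seq.
by rewrite !modn_small ?lt_max //; apply: f_inj.
Qed.

(* Truncated subtraction is harmless below, as k ranges over 1, ..., n. *)

Lemma S_exists (n : nat) :
  exists m, (1 < m) && distinct_residues (fun k => 2 * k * (k - 1)) n m.
Proof.
by apply: distinct_residues_exists => x y; rewrite !mem_iota; nia.
Qed.

Lemma T_exists (n : nat) :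
  exists m, (1 < m) && distinct_residues (fun k => k * (k - 1)) n m.
Proof.
by apply: distinct_residues_exists => x y; rewrite !mem_iota; nia.
Qed.

Definition S_min (n : nat) : nat := ex_minn (S_exists n).

Definition T_min (n : nat) : nat := ex_minn (T_exists n).

Definition is_least (P : nat -> Prop) (m : nat) : Prop :=
  P m /\ forall k, P k -> m <= k.

(* Main.v *)
(** Since k(k-1) - l(l-1) = (k-l)(k+l-1), the residues collide modulo m exactly
when m divides ab (resp. 2ab) for some positive a, b of opposite parity with
a + b <= 2n - 1.  Primes m >= 2n - 1, and in the second case powers of 2, admit no
such pair.  If m < 2n - 1, take b = m and a in {1, 2}.  By Bertrand's postulate
the least good modulus m is at most 4n - 4.  If it is an odd composite m = qd
with d its least prime factor, then (q, 2d) collides; if it is even, then either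
m/2 < 2n - 1 already collides (first case), or m = 2^e r with r > 1 odd and
(r, 2^e) collides (second case).  Bertrand's postulate is proved following
Erdos, by estimating the prime factorisation of 'C(2n, n). *)

Require Import Defs.
From mathcomp Require Import all_boot.
From mathcomp Require Import zify.

Set Implicit Arguments.
Unset Strict Implicit.
Unset Printing Implicit Defensive.

(** * Bertrand's postulate *)

Lemma central_bin_rec n :
  n.+1 * 'C(n.+1.*2, n.+1) = (n.*2.+1).*2 * 'C(n.*2, n).
Proof.
rewrite doubleS -mul_bin_diag /=.
have := mul_bin_down n.*2.+1 n; rewrite /=; nia.
Qed.

(** By [central_bin_rec], passing from n to n + 1 multiplies the right side by 2(2n + 1)/n, which
    exceeds 4. *)
Lemma exp4_le_central_bin n : 0 < n -> 4 ^ n <= n.*2 * 'C(n.*2, n).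
Proof.
elim: n => // -[|n] IHn _; first by [].
have := IHn isT; have := central_bin_rec n.+1; rewrite [4 ^ n.+2]expnS; nia.
Qed.

(** Consecutive coefficients have ratio 2(2m + 3)/(m + 2) < 4. *)
Lemma bin_middle_le m : 'C(m.*2.+1, m) <= 4 ^ m.
Proof.
elim: m => // m IHm; rewrite doubleS expnS.
have := mul_bin_diag m.*2.+3 m; have := mul_bin_down m.*2.+2 m.
rewrite [m.*2.+3.-1]/= [m.*2.+2.-1]/=.
set x := 'C(m.*2.+1, m) in IHm *; set y := 'C(m.*2.+2, m).
set z := 'C(m.*2.+3, m.+1) => e1 e2.
have e3 : m.+2 * m.+1 * z = m.*2.+3 * m.*2.+2 * x by nia.
have : m.+2 * m.+1 * z <= m.+2 * m.+1 * (4 * 4 ^ m) by rewrite e3; nia.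
by rewrite leq_pmul2l.
Qed.

(** * The primorial bound *)

Lemma prime_dvd_fact p n : prime p -> (p %| n`!) = (p <= n).
Proof.
move=> p_pr; elim: n => [|n IHn].
  by rewrite fact0 dvdn1 leqn0; have := prime_gt1 p_pr; lia.
rewrite factS Euclid_dvdM // IHn.
have [/dvdn_leq-> //|] := boolP (p %| n.+1).
by move=> h; case: eqP h (leq_eqVlt p n.+1) => [->|_ _ ->//]; rewrite dvdnn.
Qed.

Lemma prod_primes_dvd (s : seq nat) N :
    uniq s -> {in s, forall p, prime p && (p %| N)} ->
  \prod_(p <- s) p %| N.
Proof.
elim: s N => [|p s IHs] N /=; first by rewrite big_nil dvd1n.
move=> /andP[ps us] h; rewrite big_cons.
have /andP[p_pr pN] := h p (mem_head _ _).
case/dvdnP: pN h => N' -> h; rewrite mulnC dvdn_pmul2r ?prime_gt0 //.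
apply: IHs => // q qs; have := h q; rewrite inE qs orbT => /(_ isT).
case/andP=> q_pr; rewrite q_pr Euclid_dvdM // => /orP[//|].
by rewrite dvdn_prime2 // => /eqP eqp; rewrite -eqp qs in ps.
Qed.

(** Strong induction. An even n > 2 adds no prime; for n = 2m + 1 the primes from m + 2 to n all
    divide 'C(2m + 1, m) <= 4 ^ m. *)
Lemma primorial_le n : \prod_(0 <= p < n.+1 | prime p) p <= 4 ^ n.
Proof.
elim/ltn_ind: n => n IHn.
case: (ltnP n 3) => [|n_gt2].
  case: n IHn => [|[|[|//]]] _ _; rewrite unlock //=.
have [n_odd|n_even] := boolP (odd n); last first.
  rewrite big_mkcond big_nat_recr //=.
  have /negPf-> : ~~ prime n.
    by apply/negP => /even_prime[|/idP]; [lia|rewrite (negPf n_even)].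
  rewrite muln1 -big_mkcond /=.
  have := IHn n.-1; rewrite prednK; last lia.
  move=> /(_ ltac:(lia)) h; apply: leq_trans h _; rewrite leq_exp2l //; lia.
set m := n./2; have en : n = m.*2.+1 by rewrite -[n]odd_double_half n_odd.
rewrite en (@big_cat_nat _ _ _ m.+2) //=; last by rewrite en in n_gt2; lia.
have -> : 4 ^ m.*2.+1 = 4 ^ m.+1 * 4 ^ m by rewrite -expnD; congr (_ ^ _); lia.
apply: leq_mul; first by apply: IHn; lia.
apply: leq_trans (bin_middle_le m); apply: dvdn_leq; first by rewrite bin_gt0; lia.
rewrite -big_filter; apply: prod_primes_dvd.
  by rewrite filter_uniq // iota_uniq.
move=> p; rewrite mem_filter mem_index_iota => /and3P[p_pr mp pn].
rewrite p_pr /=.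
have : p %| (m.*2.+1)`! by rewrite prime_dvd_fact.
rewrite -(@bin_fact _ m); last lia.
rewrite !Euclid_dvdM // !prime_dvd_fact //.
by case/or3P=> //; lia.
Qed.

(** * Valuations of the central binomial coefficient *)

Lemma sum_nat_leq_bound N L : \sum_(1 <= k < N) (k <= L) <= L.
Proof.
suff : \sum_(1 <= k < N) (k <= L) <= minn N.-1 L by rewrite leq_min => /andP[].
elim: N => [|[|N] IHN]; [by rewrite big_geq|by rewrite big_geq|].
by rewrite big_nat_recr //=; move: IHN => /=; lia.
Qed.

Lemma logn_central_bin p n : prime p ->
  logn p 'C(n.*2, n) = \sum_(1 <= k < n.*2.+1) (n.*2 %/ p ^ k - (n %/ p ^ k).*2).
Proof.
move=> p_pr.
have hsub : n.*2 - n = n by lia.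
have := congr1 (logn p) (@bin_fact n.*2 n ltac:(lia)).
rewrite hsub !lognM ?muln_gt0 ?fact_gt0 ?bin_gt0 //; last lia.
rewrite !logn_fact // addnn.
(* The terms with k > n vanish since n < p ^ k, so both Legendre sums get the same range. *)
have -> : \sum_(1 <= k < n.+1) n %/ p ^ k = \sum_(1 <= k < n.*2.+1) n %/ p ^ k.
  rewrite [RHS](@big_cat_nat _ _ _ n.+1) //=; last lia.
  rewrite [X in _ + X]big1_seq ?addn0 // => k; rewrite mem_index_iota => /andP[_ hk].
  rewrite divn_small //; have := ltn_expl k (prime_gt1 p_pr); lia.
rewrite sumnB => [|k _]; last first.
  by rewrite leq_divRL ?expn_gt0 ?prime_gt0 // -doubleMl leq_double leq_divM.
have -> : \sum_(1 <= k < n.*2.+1) (n %/ p ^ k).*2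
          = (\sum_(1 <= k < n.*2.+1) n %/ p ^ k).*2.
  by rewrite -[RHS]mul2n big_distrr /=; apply: eq_bigr => k _; rewrite mul2n.
by move=> <-; rewrite addnK.
Qed.

(** Each term of Legendre's sum is 0 or 1, and it is 0 once p ^ k > 2n; so the valuation is at most
    the integer part of log_p(2n). *)
Lemma pfactor_central_bin_le p n : prime p -> 0 < n ->
  p ^ logn p 'C(n.*2, n) <= n.*2.
Proof.
move=> p_pr n_gt0; have p_gt1 := prime_gt1 p_pr.
apply: leq_trans (trunc_logP p_gt1 (_ : 0 < n.*2)); last lia.
rewrite leq_exp2l // logn_central_bin //.
apply: leq_trans (sum_nat_leq_bound n.*2.+1 _); apply: leq_sum => k _.
have pk_gt0 : 0 < p ^ k by rewrite expn_gt0 prime_gt0.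
have [kL|Lk] := leqP k; last first.
  rewrite divn_small //; apply: leq_trans (trunc_log_ltn _ p_gt1) _.
  by rewrite leq_exp2l.
have := divn_eq n (p ^ k); have := ltn_pmod n pk_gt0.
set q := n %/ p ^ k; set r := n %% p ^ k => r_lt n_eq.
suff : n.*2 %/ p ^ k < q.*2 + 2 by lia.
by rewrite ltn_divLR //; nia.
Qed.

(** The term k = 1 is 2 - 2 * 1, and for k >= 2 already p ^ k >= 3p > 2n. *)
Lemma logn_central_bin_eq0 p n :
  prime p -> 2 < p -> p <= n -> n.*2 < 3 * p -> logn p 'C(n.*2, n) = 0.
Proof.
move=> p_pr p_gt2 pn np; rewrite logn_central_bin // big1_seq // => k.
rewrite mem_index_iota => /andP[_ /andP[]]; case: k => // -[_ _|k _ _].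
  suff [-> ->] : n.*2 %/ p ^ 1 = 2 /\ n %/ p ^ 1 = 1 by [].
  rewrite expn1; split.
    by apply/eqP; rewrite eqn_leq -ltnS ltn_divLR ?leq_divRL; lia.
  by apply/eqP; rewrite eqn_leq -ltnS ltn_divLR ?leq_divRL; lia.
rewrite divn_small //; apply: leq_trans np _; rewrite !expnS mulnA.
by have : 0 < p ^ k; [rewrite expn_gt0; lia|nia].
Qed.

(** * Assembling the estimates *)

Lemma exp6_lt_exp2 s : 30 <= s -> s.+1 ^ 6 < 2 ^ s.
Proof.
elim: s => // s IHs; rewrite leq_eqVlt => /orP[/eqP<-|s_ge].
  (* Base case: 31 < 2 ^ 5. *)
  by rewrite -[30]/(5 * 6) expnM ltn_exp2r.
have {IHs} := IHs s_ge; rewrite [2 ^ s.+1]expnS.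
suff : s.+2 ^ 6 <= 2 * s.+1 ^ 6 by lia.
(* Cubing this suffices because (5/4)^3 = 125/64 < 2. *)
have h : 4 * s.+2 ^ 2 <= 5 * s.+1 ^ 2 by rewrite -!mulnn; nia.
have : (4 * s.+2 ^ 2) ^ 3 <= (5 * s.+1 ^ 2) ^ 3 by rewrite leq_exp2r.
rewrite (expnMn 4) (expnMn 5) -!expnM -[2 * 3]/6 -[4 ^ 3]/64 -[5 ^ 3]/125; lia.
Qed.

Lemma sqrtn_exists N : exists s, s * s <= N < s.+1 * s.+1.
Proof.
elim: N => [|N [s /andP[h1 h2]]]; first by exists 0.
by have [h|h] := ltnP N.+1 (s.+1 * s.+1); [exists s|exists s.+1]; nia.
Qed.

(** The prime factorisation is cut at s and at K = 2n/3. The s - 1 indices from 2 to s contribute at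
    most 2n each; primes in (s, K] have exponent at most 1, as p ^ 2 > 2n, and fall under the
    primorial bound; larger primes do not occur. *)
Lemma central_bin_le n s :
    2 < n -> 0 < s -> n.*2 < s.+1 * s.+1 -> s <= n.*2 %/ 3 ->
    (forall p, prime p -> n < p -> n.*2 < p) ->
  'C(n.*2, n) <= n.*2 ^ s.-1 * 4 ^ (n.*2 %/ 3).
Proof.
move=> n_gt2 s_gt0 ns sK noprime; set K := n.*2 %/ 3 in sK *.
set C := 'C(n.*2, n); have C_gt0 : 0 < C by rewrite bin_gt0; lia.
have np p : ~~ prime p -> p ^ logn p C = 1 by rewrite lognE => /negPf->.
have pf p : p ^ logn p C <= n.*2.
  have [p_pr|/np->] := boolP (prime p); last lia.
  by apply: pfactor_central_bin_le => //; lia.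
(* The bound [C + K] keeps the cut at [K] inside the range. *)
rewrite -{1}(partnT C_gt0) (@widen_partn (C + K)) ?leq_addr //.
rewrite (@big_cat_nat _ _ _ s.+1) //=; last lia.
rewrite [X in _ * X](@big_cat_nat _ _ _ K.+1) //=; last lia.
rewrite (@big_cat_nat _ _ _ 2 0 s.+1) //=.
rewrite [X in X * _ * _]big1_seq ?mul1n; last first.
  by move=> [|[|p]]; rewrite mem_index_iota // => _; apply: np.
apply: leq_mul.
  have <- : s.+1 - 2 = s.-1 by lia.
  by rewrite -prod_nat_const_nat; apply: leq_prod => p _.
rewrite [X in _ * X]big1_seq ?muln1; last first.
  move=> p; rewrite mem_index_iota => /andP[_ /andP[Kp _]].
  have [p_pr|/np->//] := boolP (prime p).
  have p3 : n.*2 < 3 * p by rewrite mulnC -ltn_divLR.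
  have [pn|pn] := leqP p n; first by rewrite logn_central_bin_eq0 //; lia.
  have := noprime p p_pr pn; have := pf p.
  by case: (logn p C) => // k; rewrite expnS; have : 0 < p ^ k; [rewrite expn_gt0; lia|nia].
apply: leq_trans (primorial_le K).
rewrite [X in _ <= X](@big_cat_nat _ _ _ s.+1) //=.
apply: leq_trans (leq_pmull _ _); last first.
  by apply: prodn_cond_gt0 => p /prime_gt0.
rewrite [X in _ <= X]big_mkcond /= big_nat_cond [X in _ <= X]big_nat_cond.
apply: leq_prod => p /andP[/andP[sp _] _].
case: ifPn => [p_pr|/np->//].
rewrite -[X in _ <= X]expn1 leq_exp2l ?prime_gt1 //.
rewrite leqNgt; apply/negP => l2.
have : p ^ 2 <= n.*2 by apply: leq_trans (pf p); rewrite leq_exp2l // prime_gt1.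
by rewrite -mulnn; nia.
Qed.

Theorem bertrand n : 0 < n -> exists2 p, prime p & n < p <= n.*2.
Proof.
move=> n_gt0; have [n_small|n_big] := ltnP n 631.
  have step q : prime q -> n < q -> q./2 <= n -> ~~ odd q || (q./2 < n) ->
      exists2 p, prime p & n < p <= n.*2.
    by move=> q_pr *; exists q => //; lia.
  (* A chain of primes, each less than twice its predecessor. *)
  case: (ltnP n 2) => h0; first by apply: (step 2) => //; lia.
  case: (ltnP n 3) => h1; first by apply: (step 3) => //; lia.
  case: (ltnP n 5) => h2; first by apply: (step 5) => //; lia.
  case: (ltnP n 7) => h3; first by apply: (step 7) => //; lia.
  case: (ltnP n 13) => h4; first by apply: (step 13) => //; lia.
  case: (ltnP n 23) => h5; first by apply: (step 23) => //; lia.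
  case: (ltnP n 43) => h6; first by apply: (step 43) => //; lia.
  case: (ltnP n 83) => h7; first by apply: (step 83) => //; lia.
  case: (ltnP n 163) => h8; first by apply: (step 163) => //; lia.
  case: (ltnP n 317) => h9; first by apply: (step 317) => //; lia.
  by apply: (step 631) => //; lia.
have [/hasP[p]|/hasPn noprime] := boolP (has prime (index_iota n.+1 n.*2.+1)).
  by rewrite mem_index_iota => h p_pr; exists p => //; lia.
have [s /andP[s_le s_gt]] := sqrtn_exists n.*2.
have s_ge : 30 <= s by nia.
have sK : s <= n.*2 %/ 3 by rewrite leq_divRL //; nia.
have C_le : 'C(n.*2, n) <= n.*2 ^ s.-1 * 4 ^ (n.*2 %/ 3).
  apply: central_bin_le => //; try lia; move=> p p_pr np.
  rewrite ltnNge; apply/negP => pn.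
  by have := noprime p; rewrite mem_index_iota p_pr; lia.
have := exp4_le_central_bin n_gt0.
have {C_le} : n.*2 * 'C(n.*2, n) <= n.*2 ^ s * 4 ^ (n.*2 %/ 3).
  by rewrite -[X in _ ^ X * _](@prednK s) ?expnS -?mulnA ?leq_pmul2l //; lia.
move=> /[swap] /leq_trans/[apply] h.
(* Cubing removes the division by 3; cancelling 4 ^ 2n then leaves 4 ^ n <= (2n) ^ 3s. *)
have : (4 ^ n) ^ 3 <= (n.*2 ^ s * 4 ^ (n.*2 %/ 3)) ^ 3 by rewrite leq_exp2r.
rewrite expnMn -!expnM => {}h.
have {h} : 4 ^ (n * 3) <= n.*2 ^ (s * 3) * 4 ^ n.*2.
  by apply: leq_trans h _; rewrite leq_mul2l leq_exp2l ?leq_divM ?orbT.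
have -> : n * 3 = n + n.*2 by lia.
rewrite expnD leq_pmul2r ?expn_gt0 // -[4]/(2 ^ 2) -expnM mul2n => h.
(* With s^2 <= 2n < (s + 1)^2 only s remains, and taking s-th roots contradicts [exp6_lt_exp2]. *)
have {h} : 2 ^ (s * s) <= (s.+1 ^ 6) ^ s.
  apply: leq_trans (_ : 2 ^ n.*2 <= _); first by rewrite leq_exp2l.
  apply: leq_trans h _; rewrite -expnM mulnC -[6]/(2 * 3) -mulnA (expnM _ 2).
  by rewrite [3 * s]mulnC leq_exp2r -?mulnn; lia.
rewrite expnM leq_exp2r; last lia.
by have := exp6_lt_exp2 s_ge; lia.
Qed.

(** * Collisions of residues *)

(* Here a = k - l and b = k + l - 1; conversely any a < b of opposite parity
   come from l = (b - a + 1) / 2 and k = (a + b + 1) / 2. *)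
Lemma distinct_residuesP f c n m :
    (forall k l, 0 < l < k -> f k = f l + c * ((k - l) * (k + l - 1))) ->
  distinct_residues f n m <->
  (forall a b, 0 < a -> 0 < b -> odd (a + b) -> a + b < n.*2 ->
     ~~ (m %| c * (a * b))).
Proof.
move=> f_diff.
have f_mod k l : 0 < l < k ->
    (f k == f l %[mod m]) = (m %| c * ((k - l) * (k + l - 1))).
  by move=> /f_diff->; rewrite eqn_mod_dvd ?leq_addr // addKn.
split=> [f_uniq|no_coll].
  have half a b : 0 < a < b -> odd (a + b) -> a + b < n.*2 ->
      ~~ (m %| c * (a * b)).
    (* Here [k] and [l] are positions in [iota 1 n], one less than the arguments of [f]. *)
    move=> ab oab abn; set k := (a + b)./2; set l := (b - a)./2.
    have /= := f_mod k.+1 l.+1 ltac:(lia).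
    have -> : k.+1 - l.+1 = a by lia.
    have -> : k.+1 + l.+1 - 1 = b by lia.
    move=> <-; apply/negP => /eqP e.
    have kn : k < n by lia.
    have ln : l < n by lia.
    move/(uniqP 0): f_uniq => /(_ k l); rewrite !inE size_map size_iota kn ln.
    rewrite !(nth_map 0) ?size_iota // !nth_iota // !add1n.
    by move=> /(_ isT isT e); lia.
  move=> a b a0 b0 oab abn; have [ab|ba|e] := ltngtP a b.
  - by apply: half; rewrite ?a0.
  - by rewrite [a * b]mulnC; apply: half; rewrite ?b0 // addnC.
  - by rewrite e addnn odd_double in oab.
rewrite /distinct_residues map_inj_in_uniq ?iota_uniq //.
have no k l : 0 < l < k -> k <= n -> f k %% m != f l %% m.
  by move=> lk kn; rewrite f_mod //; apply: no_coll; lia.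
move=> k l; rewrite !mem_iota => kn ln e.
have [kl|lk|//] := ltngtP k l.
- by have := no l k ltac:(lia) ltac:(lia); rewrite e eqxx.
- by have := no k l ltac:(lia) ltac:(lia); rewrite e eqxx.
Qed.

Lemma distinct_residues_SP n m :
  distinct_residues (fun k => 2 * k * (k - 1)) n m <->
  (forall a b, 0 < a -> 0 < b -> odd (a + b) -> a + b < n.*2 ->
     ~~ (m %| 2 * (a * b))).
Proof. by apply: distinct_residuesP => k l kl; nia. Qed.

Lemma distinct_residues_TP n m :
  distinct_residues (fun k => k * (k - 1)) n m <->
  (forall a b, 0 < a -> 0 < b -> odd (a + b) -> a + b < n.*2 ->
     ~~ (m %| 1 * (a * b))).
Proof. by apply: distinct_residuesP => k l kl; nia. Qed.

(** * Moduli without and with collisions *)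

Lemma prime_no_collision p n a b :
    prime p -> 2 * n - 2 < p -> 0 < a -> 0 < b -> a + b < n.*2 ->
  ~~ (p %| 2 * (a * b)).
Proof.
move=> p_pr np a0 b0 abn; rewrite !Euclid_dvdM // !negb_or.
(* Positivity of a and b forces n >= 2, so 2, a and b are all below p. *)
by apply/and3P; split; apply/negP => /dvdn_leq; lia.
Qed.

(** Exactly one of a, b is odd, so 2 ^ e would divide the other, which is at most 2n - 2. *)
Lemma pow2_no_collision e n a b :
    2 * n - 1 <= 2 ^ e -> 0 < a -> 0 < b -> odd (a + b) -> a + b < n.*2 ->
  ~~ (2 ^ e %| a * b).
Proof.
move=> ne a0 b0 oab abn; have [oa|ea] := boolP (odd a).
  rewrite Gauss_dvdr ?coprimeXl ?coprime2n //.
  by apply/negP => /dvdn_leq; lia.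
have ob : odd b by move: oab; rewrite oddD (negPf ea).
rewrite Gauss_dvdl ?coprimeXl ?coprime2n //.
by apply/negP => /dvdn_leq; lia.
Qed.

(** Stated without the factor 2: in the first case, a collision modulo k rules out every modulus
    dividing 2k. *)
Definition collision (n m : nat) : Prop :=
  exists a b, [/\ 0 < a, 0 < b, odd (a + b), a + b < n.*2 & m %| a * b].

Lemma small_modulus_collision n m : 1 < m -> m < 2 * n - 1 ->
  collision n m.
Proof.
(* The first witness has parity opposite to m; for odd m the bound improves to m <= 2n - 3, which
   leaves room for 2. *)
move=> m1 mn; exists (1 + odd m), m; split; try lia.
exact: dvdn_mull.
Qed.

Lemma odd_composite_collision n m :
    1 < m -> odd m -> ~~ prime m -> 2 * n - 1 <= m -> 1 < n ->
    (forall p, prime p -> 2 * n - 2 < p -> m <= p) ->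
  collision n m.
Proof.
move=> m1 om npm nm n1 m_min.
have m_le : m <= 4 * n - 4.
  have [p p_pr /andP[np pn]] := @bertrand (2 * n - 2) ltac:(lia).
  by have := m_min p p_pr np; lia.
have m7 : 2 * n - 2 < 7 -> m <= 7 by apply: m_min.
have m11 : 2 * n - 2 < 11 -> m <= 11 by apply: m_min.
have m17 : 2 * n - 2 < 17 -> m <= 17 by apply: m_min.
set d := pdiv m; set q := m %/ d.
have mE : m = q * d by rewrite divnK // pdiv_dvd.
have d_pr : prime d by rewrite pdiv_prime.
have dd : d * d <= m.
  by rewrite leqNgt mulnn; apply: contra npm => /ltn_pdiv2_prime->//; lia.
have [oq od] : odd q /\ odd d by apply/andP; rewrite -oddM -mE.
have d3 : 2 < d by have := prime_gt1 d_pr; lia.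
have dq : d <= q by rewrite -(leq_pmul2r (prime_gt0 d_pr)) -mE.
move: mE dd oq od d3 dq; clearbody q d => {d_pr npm m_min} mE dd oq od d3 dq.
(* As d is the least divisor, q + 2d is well below 2n unless n is small, and
   then the primes 7, 11 and 17 bound m. *)
exists q, d.*2; split; try lia; last by rewrite -muln2 mulnA -mE dvdn_mulr.
have [n9|n9] := leqP 9 n.
  have [d_eq|d5] : d = 3 \/ 5 <= d by lia.
    lia.
  have [q_eq|q6] : q = 5 \/ 6 <= q by lia.
    lia.
  (* Equivalent to (q - 4)(d - 2) >= 6; with qd <= 4n - 4 it yields q + 2d <= 2n - 1. *)
  suff : 2 * q + 4 * d <= q * d + 2 by lia.
  by clear -d5 q6; nia.
have m_le17 : m <= 17 by apply: m17; lia.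
(* Only m = 9 and m = 15 remain, with pairs (3, 6) and (5, 6); the primes 7 and 11 exclude the n too
   small for these. *)
have d_eq : d = 3 by clear -dd d3 od m_le17; nia.
lia.
Qed.

Lemma even_composite_collision n m :
    1 < m -> ~~ odd m -> (forall e, m <> 2 ^ e) -> m <= 4 * n - 4 ->
  collision n m.
Proof.
move=> m1 em np2 m_le.
have [r] := @pfactor_coprime 2 m isT ltac:(lia).
rewrite coprime2n; set e := logn 2 m => or mE.
have e0 : 0 < e by rewrite logn_gt0 mem_primes dvdn2 em (ltnW m1).
have r1 : r <> 1 by move=> r1; apply: (np2 e); rewrite mE r1 mul1n.
have oe : odd (2 ^ e) = false by rewrite oddX orbF gtn_eqF.
have e2 : 1 < 2 ^ e by rewrite -{1}(expn0 2) ltn_exp2l.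
exists r, (2 ^ e); split; rewrite -?mE //; try lia.
(* From (r - 2)(2 ^ e - 2) >= 0 and m <= 4n - 4 follows r + 2 ^ e <= 2n; oddness of the sum makes
   this strict. *)
have : odd (r + 2 ^ e) by rewrite oddD or oe.
have : 2 < r by lia.
nia.
Qed.

(** * The least moduli *)

Lemma S_min_prime n : 0 < n -> prime (S_min n) /\ 2 * n - 2 < S_min n.
Proof.
rewrite /S_min => n0; case: ex_minnP => m /andP[m1 /distinct_residues_SP m_dist] m_min.
have m_le p : prime p -> 2 * n - 2 < p -> m <= p.
  move=> p_pr np; apply: m_min; rewrite prime_gt1 //=.
  by apply/distinct_residues_SP => a b *; apply: (@prime_no_collision p n).
have no k : 1 < k -> m %| 2 * k -> ~ collision n k.
  move=> k1 mk [a [b [a0 b0 oab abn kab]]].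
  have /negP := m_dist a b a0 b0 oab abn; apply; apply: dvdn_trans mk _.
  by rewrite dvdn_pmul2l.
have nm : 2 * n - 1 <= m.
  rewrite leqNgt; apply/negP => mn; apply: (no m) => //; first exact: dvdn_mull.
  exact: small_modulus_collision.
split; last lia.
(* For n = 1 Bertrand's postulate would be applied to 0, so this case is settled directly. *)
have [n1|n1] := leqP n 1; first by have -> : m = 2 by have := m_le 2 isT; lia.
apply/negPn/negP => npm.
have [om|em] := boolP (odd m).
  apply: (no m) => //; first exact: dvdn_mull.
  exact: odd_composite_collision.
have [p p_pr /andP[np pn]] := @bertrand (2 * n - 2) ltac:(lia).
have := m_le p p_pr np => mp.
(* Bertrand gives m <= 4n - 4, so m/2 <= 2n - 2 is a small modulus. *)
apply: (no m./2); [lia|by rewrite mul2n even_halfK|].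
by apply: small_modulus_collision; lia.
Qed.

Lemma T_min_prime_or_pow2 n : 0 < n ->
  2 * n - 1 <= T_min n /\
  (prime (T_min n) \/ exists2 a, 0 < a & T_min n = 2 ^ a).
Proof.
rewrite /T_min => n0; case: ex_minnP => m /andP[m1 /distinct_residues_TP m_dist] m_min.
have m_le p : prime p -> 2 * n - 2 < p -> m <= p.
  move=> p_pr np; apply: m_min; rewrite prime_gt1 //=.
  apply/distinct_residues_TP => a b a0 b0 _ abn.
  have := @prime_no_collision p n a b p_pr np a0 b0 abn.
  by apply: contra; rewrite mul1n => h; apply: dvdn_mull.
have no : ~ collision n m.
  move=> [a [b [a0 b0 oab abn kab]]].
  by have /negP := m_dist a b a0 b0 oab abn; rewrite mul1n.
have nm : 2 * n - 1 <= m.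
  by rewrite leqNgt; apply/negP => mn; apply: no; apply: small_modulus_collision.
split=> //.
have [n1|n1] := leqP n 1; first by left; have -> : m = 2 by have := m_le 2 isT; lia.
have [|npm] := boolP (prime m); [by left|right].
have [om|em] := boolP (odd m).
  by case: no; apply: odd_composite_collision.
have [p p_pr /andP[np pn]] := @bertrand (2 * n - 2) ltac:(lia).
have := m_le p p_pr np => mp.
(* If m is a power of 2, its exponent can only be its 2-adic valuation. *)
have [/eqP e|/eqP ne] := boolP (m == 2 ^ logn 2 m).
  by exists (logn 2 m) => //; rewrite logn_gt0 mem_primes dvdn2 em (ltnW m1).
case: no; apply: even_composite_collision => //; last lia.
by move=> e e2; apply: ne; rewrite {2}e2 pfactorK.
Qed.

Theorem theorem1p1 :
  (forall n : nat, 0 < n ->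
     is_least (fun p => prime p /\ 2 * n - 2 < p) (S_min n))
  /\
  (forall n : nat, 0 < n ->
     is_least (fun m => 2 * n - 1 <= m /\
                        (prime m \/ exists2 a : nat, 0 < a & m = 2 ^ a))
              (T_min n)).
Proof.
split=> n n0; split; first exact: S_min_prime.
- move=> p [p_pr np]; rewrite /S_min; case: ex_minnP => m _; apply.
  rewrite prime_gt1 //=.
  by apply/distinct_residues_SP => a b *; apply: (@prime_no_collision p n).
- exact: T_min_prime_or_pow2.
move=> k [nk hk]; rewrite /T_min; case: ex_minnP => m _; apply.
apply/andP; split.
  case: hk => [/prime_gt1//|[a a0 ->]].
  by rewrite -{1}(expn0 2) ltn_exp2l.
apply/distinct_residues_TP => a b a0 b0 oab abn; rewrite mul1n.
case: hk nk => [k_pr|[e _ ->]] nk; last exact: (@pow2_no_collision e n).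
have := @prime_no_collision k n a b k_pr ltac:(lia) a0 b0 abn.
by apply: contra => h; apply: dvdn_mull.
Qed.
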